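(* Let $(\hat{\mathcal G}(A,D),p,\mathcal V_a)$ be a sensor network in $\mathbb R^2$ such that Problem 1 is feasible, $\mathcal V_a\cap\mathcal V_A\ne\emptyset$ and $\mathcal V_a\cap\mathcal V_D\neq\emptyset$. Then Problem 1 is equivalent to Problem 2, in the sense that an explicit bijection can be built between the solution sets of them.
   Context: Sensor network: $\mathcal V=\{1,\dots,n\}=\mathcal V_a\cup\mathcal V_f$ (anchors $\mathcal V_a=\{1,\dots,n_a\}$, free nodes $\mathcal V_f=\{n_a+1,\dots,n\}$), $n\ge3$; $\mathcal G=(\mathcal V,\mathcal E)$ is a connected simple undirected graph with a node bipartition $\mathcal V=\mathcal V_A\cup\mathcal V_D$ ($\mathcal V_A,\mathcal V_D$ disjoint and nonempty). The true node locations are $p=(p_1^\top,\dots,p_n^\top)^\top\in\mathbb R^{2n}$ with pairwise distinct $p_i\in\mathbb R^2$. $\hat{\mathcal G}=(\mathcal V,\hat{\mathcal E})$, where $\hat{\mathcal E}$ is $\mathcal E$ together with all edges between pairs of distinct anchors; $m=|\hat{\mathcal E}|$. $\mathcal T_{\hat A}=\{(u,v,w)\in\mathcal V^3:u\in\mathcal V_A,(u,v),(u,w)\in\hat{\mathcal E},v<w\}$; $\mathcal T_{\hat D}$ likewise with $u\in\mathcal V_D$. Measurements: for $(i,j,k)\in\mathcal T_{\hat A}$, $\theta_{ijk}\in[0,2\pi)$ is the counter-clockwise signed angle from $p_j-p_i$ to $p_k-p_i$; for $(r,s,t)\in\mathcal T_{\hat D}$, $\kappa_{rst}=\|p_t-p_r\|/\|p_s-p_r\|$.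 $\mathcal R(\theta)$ is the counter-clockwise rotation matrix. Problem 1: find $x=(x_1^\top,\dots,x_n^\top)^\top\in\mathbb R^{2n}$ (with $x_i\ne x_j$ for $(i,j)\in\hat{\mathcal E}$) such that $\frac{x_k-x_i}{\|x_k-x_i\|}=\mathcal R(\theta_{ijk})\frac{x_j-x_i}{\|x_j-x_i\|}$ for $(i,j,k)\in\mathcal T_{\hat A}$, $\frac{\|x_t-x_r\|}{\|x_s-x_r\|}=\kappa_{rst}$ for $(r,s,t)\in\mathcal T_{\hat D}$, and $x_i=p_i$ for $i\in\mathcal V_a$. Problem 2: find $d_{ij}\in\mathbb R$, $b_{ij}\in\mathbb R^2$ for $(i,j)\in\hat{\mathcal E}$ (one pair per edge, with the conventions $d_{ji}=d_{ij}$, $b_{ji}=-b_{ij}$) such that $b_{ik}-\mathcal R(\theta_{ijk})b_{ij}=0$ for $(i,j,k)\in\mathcal T_{\hat A}$; $d_{rt}-\kappa_{rst}d_{rs}=0$ for $(r,s,t)\in\mathcal T_{\hat D}$; $\sum_{(i,j)\in\mathcal C_k}c_{k,ij}d_{ij}b_{ij}=0$ for $k=1,\dots,m-n+1$; $d_{ij}=\|p_j-p_i\|$ and $b_{ij}=\frac{p_j-p_i}{\|p_j-p_i\|}$ for distinct $i,j\in\mathcal V_a$; $d_{ij}>0$ and $\|b_{ij}\|=1$ for $(i,j)\in\hat{\mathcal E}$. Here an orientation of $\hat{\mathcal G}$ is fixed, and $\mathcal C_1,\dots,\mathcal C_{m-n+1}$ are cycles whose signed characteristic vectors $(c_{k,ij})_{(i,j)}\in\{0,\pm1\}^m$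 ($+1$/$-1$ if the edge orientation agrees/disagrees with the traversal of the cycle, $0$ if the edge is not in the cycle) form a basis of the cycle space of $\hat{\mathcal G}$. *)

(* Defs.v *)
From mathcomp Require Import all_boot all_order all_algebra.
From mathcomp Require Import boolp classical_sets functions reals trigo.

Set Implicit Arguments.
Unset Strict Implicit.
Unset Printing Implicit Defensive.

Import Order.TTheory GRing.Theory Num.Theory.
Local Open Scope ring_scope.

(* The library norm [`|v|] on matrices is the sup norm, hence the Euclidean
   norm is spelled out here. *)
Definition enorm {R : realType} {k : nat} (v : 'cV[R]_k) : R :=
  Num.sqrt (\sum_i v i 0 ^+ 2).

Definition unitv {R : realType} {k : nat} (v : 'cV[R]_k) : 'cV[R]_k :=
  (enorm v)^-1 *: v.

Definition rot_mx {R : realType} (t : R) : 'M[R]_2 :=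
  \matrix_(i, j) if i == j then cos t
                 else if i == 0 then - sin t else sin t.

Definition dotp2 {R : realType} (u v : 'cV[R]_2) : R :=
  u 0 0 * v 0 0 + u 1 0 * v 1 0.

Definition crossp2 {R : realType} (u v : 'cV[R]_2) : R :=
  u 0 0 * v 1 0 - u 1 0 * v 0 0.

(* Counter-clockwise signed angle from [u] to [v], in [0, 2 pi[ (for nonzero
   [u], [v]): [acos] gives the unsigned angle in [0, pi], and [v] lies
   clockwise from [u] exactly when the cross product is negative. *)
Definition ccw_angle {R : realType} (u v : 'cV[R]_2) : R :=
  let t := acos (dotp2 u v / (enorm u * enorm v)) in
  if 0 <= crossp2 u v then t else 2 * pi - t.

(* Nodes are 0-indexed: the anchors are the nodes [i < nanchors]. The sets
   [angle_nodes] and [ratio_nodes] are V_A and V_D. *)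
Record sensor_network (R : realType) (n : nat) := SensorNetwork {
  nanchors : nat;
  edge : rel 'I_n;
  angle_nodes : {set 'I_n};
  ratio_nodes : {set 'I_n};
  loc : 'I_n -> 'cV[R]_2;
  node_count : (3 <= n)%N;
  anchor_count : (nanchors <= n)%N;
  edge_sym : symmetric edge;
  edge_irr : irreflexive edge;
  edge_connected : forall i j, connect edge i j;
  bipartition_cover : angle_nodes :|: ratio_nodes = [set: 'I_n];
  bipartition_disjoint : [disjoint angle_nodes & ratio_nodes];
  angle_nodes_nonempty : angle_nodes != finset.set0;
  ratio_nodes_nonempty : ratio_nodes != finset.set0;
  loc_inj : injective loc
}.

Definition anchor {R : realType} {n : nat} (N : sensor_network R n)
  : pred 'I_n := fun i => (i < nanchors N)%N.

(* The edge relation of G-hat: the edges of G and all pairs of anchors. *)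
Definition hedge {R : realType} {n : nat} (N : sensor_network R n)
  : rel 'I_n :=
  fun i j => edge N i j || [&& i != j, anchor N i & anchor N j].

Definition triples {R : realType} {n : nat} (N : sensor_network R n)
    (S : {set 'I_n}) (u v w : 'I_n) : bool :=
  [&& u \in S, hedge N u v, hedge N u w & (v < w)%N].

Definition theta {R : realType} {n : nat} (N : sensor_network R n)
    (i j k : 'I_n) : R :=
  ccw_angle (loc N j - loc N i) (loc N k - loc N i).

Definition kappa {R : realType} {n : nat} (N : sensor_network R n)
    (r s t : 'I_n) : R :=
  enorm (loc N t - loc N r) / enorm (loc N s - loc N r).

Record problem1 {R : realType} {n : nat} (N : sensor_network R n)
    (x : 'I_n -> 'cV[R]_2) : Prop := Problem1 {
  p1_distinct : forall i j, hedge N i j -> x i != x j;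
  p1_angle : forall i j k, triples N (angle_nodes N) i j k ->
    unitv (x k - x i) = rot_mx (theta N i j k) *m unitv (x j - x i);
  p1_ratio : forall r s t, triples N (ratio_nodes N) r s t ->
    enorm (x t - x r) / enorm (x s - x r) = kappa N r s t;
  p1_anchor : forall i, anchor N i -> x i = loc N i
}.

(* m, the number of undirected edges of G-hat. *)
Definition num_hedges {R : realType} {n : nat} (N : sensor_network R n)
  : nat :=
  #|[pred a : 'I_n * 'I_n | (a.1 < a.2)%N && hedge N a.1 a.2]|.

(* An orientation chooses exactly one of the two arcs of every edge. *)
Definition orientation {n : nat} (e : rel 'I_n) (O : {set 'I_n * 'I_n})
  : Prop :=
  (forall i j, (i, j) \in O -> e i j) /\
  (forall i j, e i j -> ((i, j) \in O) (+) ((j, i) \in O)).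

(* A cycle is given by its vertices listed in the order of traversal. *)
Definition simple_cycle {n : nat} (e : rel 'I_n) (c : seq 'I_n) : bool :=
  ucycleb e c && (2 < size c)%N.

Definition traverses {n : nat} (c : seq 'I_n) (i j : 'I_n) : bool :=
  (i \in c) && (next c i == j).

Definition on_cycle {n : nat} (c : seq 'I_n) (i j : 'I_n) : bool :=
  traverses c i j || traverses c j i.

(* The signed characteristic vector of [c] at the arc (i, j): 1, -1 or 0. *)
Definition cycle_sign {R : realType} {n : nat} (c : seq 'I_n) (i j : 'I_n)
  : R :=
  (traverses c i j)%:R - (traverses c j i)%:R.

Definition incidence_mx (R : realType) {n : nat} (O : {set 'I_n * 'I_n})
  : 'M[R]_(n, #|O|) :=
  \matrix_(v, a) (((enum_val a).2 == v)%:R - ((enum_val a).1 == v)%:R).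

Definition cycle_mx (R : realType) {n q : nat} (O : {set 'I_n * 'I_n})
    (C : 'I_q -> seq 'I_n) : 'M[R]_(q, #|O|) :=
  \matrix_(k, a) cycle_sign (C k) (enum_val a).1 (enum_val a).2.

(* The cycle space is the null space of the incidence matrix; the signed
   characteristic vectors, as the rows of [cycle_mx], are a basis of it. *)
Definition cycle_basis (R : realType) {n q : nat} (e : rel 'I_n)
    (O : {set 'I_n * 'I_n}) (C : 'I_q -> seq 'I_n) : Prop :=
  [/\ forall k, simple_cycle e (C k),
      row_free (cycle_mx R O C)
    & (cycle_mx R O C == kermx (incidence_mx R O)^T)%MS].

(* Candidate solutions (d, b) of Problem 2. *)
Definition edge_data (R : realType) (n : nat) : Type :=
  (('I_n -> 'I_n -> R) * ('I_n -> 'I_n -> 'cV[R]_2))%type.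

(* A family with one pair (d, b) per edge is encoded as functions of ordered
   pairs of nodes, with the stated conventions on reversed edges and value 0
   (carrying no information) on the pairs that are not edges. *)
Record per_edge {R : realType} {n : nat} (e : rel 'I_n)
    (y : edge_data R n) : Prop := PerEdge {
  dist_sym : forall i j, e i j -> y.1 j i = y.1 i j;
  bearing_antisym : forall i j, e i j -> y.2 j i = - y.2 i j;
  dist_off_edge : forall i j, ~~ e i j -> y.1 i j = 0;
  bearing_off_edge : forall i j, ~~ e i j -> y.2 i j = 0
}.

Record problem2 {R : realType} {n : nat} (N : sensor_network R n) {q : nat}
    (O : {set 'I_n * 'I_n}) (C : 'I_q -> seq 'I_n)
    (y : edge_data R n) : Prop := Problem2 {
  p2_per_edge : per_edge (hedge N) y;
  p2_angle : forall i j k, triples N (angle_nodes N) i j k ->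
    y.2 i k - rot_mx (theta N i j k) *m y.2 i j = 0;
  p2_ratio : forall r s t, triples N (ratio_nodes N) r s t ->
    y.1 r t - kappa N r s t * y.1 r s = 0;
  p2_cycle : forall k : 'I_q,
    \sum_(a in O | on_cycle (C k) a.1 a.2)
      (cycle_sign (C k) a.1 a.2 * y.1 a.1 a.2) *: y.2 a.1 a.2 = 0;
  p2_anchor_dist : forall i j, i != j -> anchor N i -> anchor N j ->
    y.1 i j = enorm (loc N j - loc N i);
  p2_anchor_bearing : forall i j, i != j -> anchor N i -> anchor N j ->
    y.2 i j = unitv (loc N j - loc N i);
  p2_dist_gt0 : forall i j, hedge N i j -> 0 < y.1 i j;
  p2_bearing_unit : forall i j, hedge N i j -> enorm (y.2 i j) = 1
}.

Definition dist_bearing {R : realType} {n : nat} (N : sensor_network R n)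
    (x : 'I_n -> 'cV[R]_2) : edge_data R n :=
  (fun i j => if hedge N i j then enorm (x j - x i) else 0,
   fun i j => if hedge N i j then unitv (x j - x i) else 0).

(* Main.v *)
(** On each edge, distance and bearing together amount to the displacement
    x_j - x_i.  The rows of [cycle_mx] span the kernel of the boundary map, so a
    displacement field satisfies the cycle equations exactly when it lies in the
    orthogonal complement of that kernel, the range of the transposed incidence
    matrix: exactly when it comes from a placement x.  As the graph is connected,
    x is then determined up to a translation, which one anchor fixes. *)
Require Import Defs.
From mathcomp Require Import all_boot all_order all_algebra.
From mathcomp Require Import boolp classical_sets functions reals trigo.

Import Order.TTheory GRing.Theory Num.Theory.

(** * Polar decomposition of vectors: length times direction *)

Section EuclideanNorm.
Local Open Scope ring_scope.
Context {R : realType} {k : nat}.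
Implicit Types (v : 'cV[R]_k) (c : R).

Lemma enorm0 : enorm (0 : 'cV[R]_k) = 0.
Proof.
by rewrite /enorm big1 ?sqrtr0 // => i _; rewrite mxE expr0n.
Qed.

Lemma enorm_gt0 v : v != 0 -> 0 < enorm v.
Proof.
move=> v0; rewrite sqrtr_gt0 lt_def sumr_ge0 ?andbT => [|i _]; last first.
  exact: sqr_ge0.
apply: contraNneq v0 => /eqP; rewrite psumr_eq0 => [/allP v0|i _]; last first.
  exact: sqr_ge0.
apply/eqP/colP => i; rewrite mxE; apply/eqP; rewrite -sqrf_eq0.
exact: (v0 _ (mem_index_enum i)).
Qed.

Lemma enormZ c v : 0 <= c -> enorm (c *: v) = c * enorm v.
Proof.
move=> c0; rewrite /enorm.
under eq_bigr do rewrite mxE exprMn.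
by rewrite -mulr_sumr sqrtrM ?sqr_ge0 // sqrtr_sqr ger0_norm.
Qed.

Lemma enormN v : enorm (- v) = enorm v.
Proof. by rewrite /enorm; under eq_bigr do rewrite mxE sqrrN. Qed.

Lemma unitvN v : unitv (- v) = - unitv v.
Proof. by rewrite /unitv enormN scalerN. Qed.

Lemma enorm_unitv v : v != 0 -> enorm (unitv v) = 1.
Proof.
move=> /enorm_gt0 v0.
by rewrite enormZ ?invr_ge0 ?(ltW v0) // mulVf ?gt_eqF.
Qed.

Lemma enorm_scale_unitv v : enorm v *: unitv v = v.
Proof.
have [->|/enorm_gt0 v0] := eqVneq v 0; first by rewrite /unitv !scaler0.
by rewrite scalerA mulfV ?scale1r ?gt_eqF.
Qed.

Lemma unitvZ c v : 0 < c -> enorm v = 1 -> unitv (c *: v) = v.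
Proof.
move=> c0 v1.
by rewrite /unitv enormZ ?(ltW c0) // v1 mulr1 scalerA mulVf ?scale1r ?gt_eqF.
Qed.

End EuclideanNorm.

(** * Edge fields without circulation and their potentials *)

Section Potential.
Local Open Scope ring_scope.

(** Double orthogonality: the rows of [(cokermx A^T)^T] annihilate [A], hence are combinations of
    the rows of [B]. So [B *m w = 0] makes [cokermx A^T] kill [w^T], which puts [w^T] in the row
    space of [A^T]. *)
Lemma kermx_orthogonal {F : fieldType} {q p n m : nat}
    {B : 'M[F]_(q, p)} {A : 'M_(p, n)} (w : 'M_(p, m)) :
  (B == kermx A)%MS -> B *m w = 0 <-> exists u, w = A *m u.
Proof.
move=> /eqmxP BA; split=> [Bw0|[u ->]]; last first.
  have /sub_kermxP BA0 : (B <= kermx A)%MS by rewrite -BA submx_refl.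
  by rewrite mulmxA BA0 mul0mx.
have /submxP[D KE] : ((cokermx A^T)^T <= B)%MS.
  by rewrite BA; apply/sub_kermxP/trmx_inj;
     rewrite trmx_mul trmxK mulmx_coker trmx0.
have /submxP[u wE] : (w^T <= A^T)%MS.
  by rewrite submxE -(inj_eq trmx_inj) trmx_mul trmxK KE -mulmxA Bw0
             mulmx0 trmx0.
by exists u^T; apply: trmx_inj; rewrite trmx_mul trmxK.
Qed.

Context {R : realType} {n q m : nat} {e : rel 'I_n} {O : {set 'I_n * 'I_n}}
  {C : 'I_q -> seq 'I_n}.

(** The rows follow the arc order of the columns of [cycle_mx], so one matrix product treats all
    coordinates at once. *)
Definition flow_mx (f : 'I_n -> 'I_n -> 'cV[R]_m) : 'M[R]_(#|O|, m) :=
  \matrix_(a, l) f (enum_val a).1 (enum_val a).2 l 0.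

Lemma cycle_sum_eq0 (f : 'I_n -> 'I_n -> 'cV[R]_m) :
  (forall k, \sum_(a in O | on_cycle (C k) a.1 a.2)
     cycle_sign (C k) a.1 a.2 *: f a.1 a.2 = 0)
  <-> cycle_mx R O C *m flow_mx f = 0.
Proof.
have sumE k l : (\sum_(a in O | on_cycle (C k) a.1 a.2)
    cycle_sign (C k) a.1 a.2 *: f a.1 a.2) l 0
    = (cycle_mx R O C *m flow_mx f) k l.
  (* The sum may run over all of [O]: off the cycle the sign is 0. *)
  rewrite summxE mxE big_mkcondr big_enum_val /=; apply: eq_bigr => a _.
  rewrite !mxE; case: ifPn => //; rewrite /on_cycle /cycle_sign.
  by move=> /norP[/negPf-> /negPf->]; rewrite subrr mul0r.
split=> [f0|f0 k].
  by apply/matrixP => k l; rewrite -sumE f0 !mxE.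
by apply/colP => l; rewrite sumE f0 !mxE.
Qed.

(** The transposed incidence matrix acts as a discrete gradient: only the head and the tail of an
    arc contribute. *)
Lemma tr_incidence_mulmxE (u : 'M[R]_(n, m)) a l :
  ((incidence_mx R O)^T *m u) a l
  = u (enum_val a).2 l - u (enum_val a).1 l.
Proof.
rewrite mxE.
under eq_bigr do rewrite !mxE mulrBl.
rewrite sumrB; congr (_ - _).
  rewrite (bigD1 (enum_val a).2) //= eqxx mul1r big1 ?addr0 // => v.
  by rewrite eq_sym => /negPf->; rewrite mul0r.
rewrite (bigD1 (enum_val a).1) //= eqxx mul1r big1 ?addr0 // => v.
by rewrite eq_sym => /negPf->; rewrite mul0r.
Qed.

Lemma cycle_basis_potential (f : 'I_n -> 'I_n -> 'cV[R]_m) :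
  cycle_basis R e O C ->
  (forall k, \sum_(a in O | on_cycle (C k) a.1 a.2)
     cycle_sign (C k) a.1 a.2 *: f a.1 a.2 = 0)
  <-> exists x : 'I_n -> 'cV[R]_m,
        forall i j, (i, j) \in O -> f i j = x j - x i.
Proof.
case=> _ _ /kermx_orthogonal-/(_ m (flow_mx f)) fP.
rewrite cycle_sum_eq0 fP; split=> [[u fE]|[x fE]].
  exists (fun i => (row i u)^T) => i j ijO; apply/colP => l.
  move/matrixP/(_ (enum_rank_in ijO (i, j)) l): fE.
  by rewrite tr_incidence_mulmxE !mxE enum_rankK_in.
exists (\matrix_(i, l) x i l 0); apply/matrixP => a l.
rewrite tr_incidence_mulmxE !mxE fE ?mxE // -surjective_pairing.
exact: enum_valP.
Qed.

(** Each edge has an arc in [O], and antisymmetry of [f] carries the formula over to the reversed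
    arc. *)
Lemma oriented_diff (f : 'I_n -> 'I_n -> 'cV[R]_m) (x : 'I_n -> 'cV[R]_m) :
  orientation e O ->
  (forall i j, e i j -> f j i = - f i j) ->
  (forall i j, (i, j) \in O -> f i j = x j - x i) ->
  forall i j, e i j -> f i j = x j - x i.
Proof.
move=> [_ eO] fN fE i j eij; have := eO i j eij.
have [/fE//|_ /= jiO] := boolP ((i, j) \in O).
by apply: oppr_inj; rewrite -fN // fE // opprB.
Qed.

End Potential.

(** * Passing between placements and edge data *)

Section Network.
Local Open Scope ring_scope.
Context {R : realType} {n : nat} {N : sensor_network R n}.
Implicit Type x : 'I_n -> 'cV[R]_2.

Lemma hedge_sym : symmetric (hedge N).
Proof.
move=> i j; rewrite /hedge (edge_sym N) eq_sym.
by rewrite [anchor N i && _]andbC.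
Qed.

Lemma anchors_hedge i j : i != j -> anchor N i -> anchor N j -> hedge N i j.
Proof. by move=> ij ai aj; rewrite /hedge ij ai aj orbT. Qed.

Lemma triplesP {S i j k} : triples N S i j k -> hedge N i j /\ hedge N i k.
Proof. by case/and4P. Qed.

Lemma dist_bearingE x i j : hedge N i j ->
  (dist_bearing N x).1 i j *: (dist_bearing N x).2 i j = x j - x i.
Proof. by move=> /= ->; exact: enorm_scale_unitv. Qed.

(** Agreement starts at the anchor [i0] and spreads along a path of the graph, one displacement at a
    time. *)
Lemma problem1_inj {x x' i0} : anchor N i0 -> problem1 N x -> problem1 N x' ->
  (forall i j, hedge N i j -> x j - x i = x' j - x' i) -> x = x'.
Proof.
move=> ai0 Px Px' xx'; apply: funext => j.
have /connectP[p] := edge_connected N i0 j.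
have: x i0 = x' i0 by rewrite (p1_anchor Px) ?(p1_anchor Px').
elim: p i0 {ai0} => [|k p IHp] i /= xi; first by move=> _ ->.
move=> /andP[ik]; apply: IHp.
have ik' : hedge N i k by rewrite /hedge ik.
by have := xx' _ _ ik'; rewrite xi => /addIr.
Qed.

Context {q : nat} {O : {set 'I_n * 'I_n}} {C : 'I_q -> seq 'I_n}.
Hypothesis hO : orientation (hedge N) O.
Hypothesis hC : cycle_basis R (hedge N) O C.

Lemma problem1_problem2 x : problem1 N x -> problem2 N O C (dist_bearing N x).
Proof.
move=> Px; have x0 i j : hedge N i j -> x j - x i != 0.
  by move=> ij; rewrite subr_eq0 eq_sym (p1_distinct Px).
split=> /=.
- split=> i j /=; rewrite ?[hedge N j i]hedge_sym.
  + by move=> ->; rewrite -enormN opprB.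
  + by move=> ->; rewrite -unitvN opprB.
  + by move/negPf->.
  + by move/negPf->.
- move=> i j k tr; have [-> ->] := triplesP tr.
  by rewrite (p1_angle Px tr) subrr.
- move=> r s t tr; have [rs ->] := triplesP tr; rewrite rs.
  by rewrite -(p1_ratio Px tr) divfK ?subrr // gt_eqF // enorm_gt0 // x0.
- move=> k; under eq_bigr do rewrite -scalerA; move: k.
  pose f i j := (dist_bearing N x).1 i j *: (dist_bearing N x).2 i j.
  (* The placement itself is a potential of its displacements. *)
  apply: (cycle_basis_potential f hC).2; exists x => i j ijO.
  by apply: dist_bearingE; apply: hO.1.
- by move=> i j ij ai aj; rewrite anchors_hedge // !(p1_anchor Px).
- by move=> i j ij ai aj; rewrite anchors_hedge // !(p1_anchor Px).
- by move=> i j ij; rewrite ij enorm_gt0 // x0.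
- by move=> i j ij; rewrite ij enorm_unitv // x0.
Qed.

Lemma problem2_placement {y i0} : anchor N i0 -> problem2 N O C y ->
  exists2 x, x i0 = loc N i0 &
    forall i j, hedge N i j -> y.1 i j *: y.2 i j = x j - x i.
Proof.
move=> ai0 Py.
have [|x xE] := (cycle_basis_potential (fun i j => y.1 i j *: y.2 i j) hC).1.
  by move=> k; under eq_bigr do rewrite scalerA; apply: (p2_cycle Py).
(* Translate the potential so that [i0] lands on its true location; differences do not change. *)
exists (fun i => x i + (loc N i0 - x i0)); first by rewrite addrC subrK.
move=> i j; rewrite opprD addrACA subrr addr0; move: i j.
apply: (oriented_diff _ _ hO _ xE) => i j ij.
by rewrite (dist_sym (p2_per_edge Py)) // (bearing_antisym (p2_per_edge Py)) //
           scalerN.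
Qed.

Lemma problem2_surj {y i0} : anchor N i0 -> problem2 N O C y ->
  exists2 x, problem1 N x & dist_bearing N x = y.
Proof.
move=> ai0 Py; have [x xi0 xE] := problem2_placement ai0 Py.
(* As the distances are positive and the bearings have norm 1, both can be read off from their
   product. *)
have dE i j : hedge N i j -> enorm (x j - x i) = y.1 i j.
  move=> ij; have d0 := p2_dist_gt0 Py ij.
  by rewrite -xE // enormZ ?(ltW d0) // (p2_bearing_unit Py) // mulr1.
have bE i j : hedge N i j -> unitv (x j - x i) = y.2 i j.
  move=> ij; rewrite -xE // unitvZ //; first exact: (p2_dist_gt0 Py ij).
  exact: (p2_bearing_unit Py ij).
exists x; last first.
  (* Equality as functions also concerns the pairs that are not edges, where both sides are 0. *)
  have := p2_per_edge Py; case: y {Py xE} dE bE => d b /= dE bE [_ _ /= d0 b0].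
  congr pair; apply/funext => i; apply/funext => j; case: ifPn => ij.
  - exact: dE.
  - by rewrite d0.
  - exact: bE.
  - by rewrite b0.
split=> [i j ij|i j k tr|r s t tr|i ai].
- apply: contraTneq (p2_dist_gt0 Py ij) => xij.
  by rewrite -dE // xij subrr enorm0 ltxx.
- have [ij ik] := triplesP tr; rewrite !bE //; apply/eqP.
  by rewrite -subr_eq0; apply/eqP/(p2_angle Py).
- have [rs rt] := triplesP tr; rewrite !dE //.
  move/eqP: (p2_ratio Py tr); rewrite subr_eq0 => /eqP->.
  by rewrite mulfK // gt_eqF // (p2_dist_gt0 Py).
(* Every other anchor is adjacent to [i0], and the prescribed distance and bearing on that edge give
   its true displacement from [i0]. *)
- have [->//|i0i] := eqVneq i i0; rewrite eq_sym in i0i.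
  apply: (addIr (- x i0)); rewrite -xE ?anchors_hedge //.
  by rewrite (p2_anchor_dist Py) // (p2_anchor_bearing Py) // xi0
             enorm_scale_unitv.
Qed.

End Network.

Theorem theorem12 (R : realType) (n : nat) (N : sensor_network R n)
    (O : {set 'I_n * 'I_n})
    (C : 'I_((num_hedges N).+1 - n) -> seq 'I_n)
    (hO : orientation (hedge N) O)
    (hC : cycle_basis R (hedge N) O C)
    (feasible1 : exists x : 'I_n -> 'cV[R]_2, problem1 N x)
    (anchor_angle : exists i : 'I_n, anchor N i && (i \in angle_nodes N))
    (anchor_ratio : exists i : 'I_n, anchor N i && (i \in ratio_nodes N)) :
  set_bij (problem1 N) (problem2 N O C) (dist_bearing N).
Proof.
(* The anchor [i0] removes the freedom of translation, for injectivity and surjectivity alike. *)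
have [i0 /andP[ai0 _]] := anchor_angle; split=> [x Px|x x'|y Py].
- exact: problem1_problem2.
- rewrite !inE => Px Px' xx'; apply: (problem1_inj ai0 Px Px') => i j ij.
  by rewrite -(dist_bearingE x i j ij) -(dist_bearingE x' i j ij) xx'.
- by have [x] := problem2_surj hO hC ai0 Py; exists x.
Qed.
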